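(* A polynomial $F\in\mathbb C[x,y,s,t]$ of degree $d$ is Cartesian if and only if there exist sets $I,J\subset\mathbb C^2$ with $|I|,|J|>d^2$ such that $I\times J\subset Z(F)$.
   Context: $I\times J$ is viewed as a subset of $\mathbb C^4$ with coordinates $(x,y,s,t)$, $I$ in the $(x,y)$-coordinates and $J$ in the $(s,t)$-coordinates; $Z(F)$ is the complex zero set of $F$. $F$ is Cartesian if there exist $G\in\mathbb C[x,y]\setminus\mathbb C$, $K\in\mathbb C[s,t]\setminus\mathbb C$ and $H,L\in\mathbb C[x,y,s,t]$ with $F=G(x,y)H(x,y,s,t)+K(s,t)L(x,y,s,t)$. *)

(* Defs.v *)
From HB Require Import structures.
From mathcomp Require Import all_boot all_order all_algebra.
From mathcomp Require Import reals.
From mathcomp Require Import complex.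
From mathcomp Require Import mpoly.
Set Implicit Arguments. Unset Strict Implicit. Unset Printing Implicit Defensive.
Import Order.TTheory GRing.Theory Num.Theory.
Local Open Scope ring_scope.

Definition CC (R : realType) := complex R.

Definition vx : 'I_4 := inord 0.
Definition vy : 'I_4 := inord 1.
Definition vs : 'I_4 := inord 2.
Definition vt : 'I_4 := inord 3.

(* Total degree of a multivariate polynomial (msize p = 1 + deg p, 0 for p = 0). *)
Definition mtdeg (K : ringType) n (p : {mpoly K[n]}) : nat := (msize p).-1.

Definition nonconst (K : ringType) n (p : {mpoly K[n]}) : Prop :=
  ~ exists c : K, p = c%:MP.

Definition in_xy (K : comRingType) (G : {mpoly K[2]}) : {mpoly K[4]} :=
  G \mPo [tuple 'X_vx; 'X_vy].
Definition in_st (K : comRingType) (G : {mpoly K[2]}) : {mpoly K[4]} :=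
  G \mPo [tuple 'X_vs; 'X_vt].

Definition cartesian (K : comRingType) (F : {mpoly K[4]}) : Prop :=
  exists (G Kp : {mpoly K[2]}) (H L : {mpoly K[4]}),
    nonconst G /\ nonconst Kp /\ F = in_xy G * H + in_st Kp * L.

Definition pt4 (K : Type) (p q : K * K) : 'I_4 -> K :=
  fun i => nth p.1 [:: p.1; p.2; q.1; q.2] (val i).

Definition card_gt (T : eqType) (A : T -> Prop) (n : nat) : Prop :=
  exists s : seq T, uniq s /\ (forall x, x \in s -> A x) /\ (n < size s)%N.

(* Main.v *)
(** A nonconstant polynomial in two variables over an algebraically closed field has
    infinitely many zeros, which settles one direction.

    Conversely, a family of polynomials of degree at most [d] in [K[x,y]] with more than
    [d^2] common zeros has a nonconstant common factor: [K[x,y]] is factorial, and a prime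
    factor [p] of a member of the family that does not divide some other member shares at
    most [d deg p] zeros with it.  Write [F = sum_l a_l(x,y) b_l(s,t)], let [E] be the
    matrix with entries [b_l(q)] for [q] in [J], and let [P = E E'] with [E E' E = E].
    Splitting the identity matrix as [P + (1 - P)] splits [F] into two parts.  In the
    first one the [x,y]-factors are combinations of the slices [F(., q)], which vanish on
    [I] and so share a factor [G].  In the second one the [s,t]-factors vanish on [J],
    because [(1 - P) E = 0], and so share a factor [H]. *)

Require Import Defs.
From HB Require Import structures.
From mathcomp Require Import all_boot all_order all_algebra.
From mathcomp Require Import boolp reals complex mpoly zify ring.
Set Implicit Arguments. Unset Strict Implicit. Unset Printing Implicit Defensive.
Import GRing.Theory.
Local Open Scope ring_scope.

(** * Unique factorization *)

Definition divides (A : comPzRingType) (a b : A) : Prop := exists c, b = a * c.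

Section Divides.
Variable A : comPzRingType.
Implicit Types a b c : A.

Lemma divides_mull a b c : divides a c -> divides a (b * c).
Proof. by case=> d ->; exists (b * d); rewrite mulrCA. Qed.

Lemma divides_mulr a b c : divides a b -> divides a (b * c).
Proof. by rewrite mulrC; apply: divides_mull. Qed.

Lemma divides_sum r a (x : 'I_r -> A) :
  (forall l, divides a (x l)) -> divides a (\sum_l x l).
Proof.
move=> dvd_x; apply: big_ind => //; first by exists 0; rewrite mulr0.
by move=> _ _ [y ->] [z ->]; exists (y + z); rewrite mulrDr.
Qed.

Lemma divides_rmorph (B : comPzRingType) (f : {rmorphism A -> B}) a b :
  divides a b -> divides (f a) (f b).
Proof. by case=> c ->; exists (f c); rewrite rmorphM. Qed.

End Divides.

Section PrimeProducts.
Variable A : idomainType.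
Implicit Types a b c p q u : A.

Definition prime_elem p : Prop :=
  [/\ p != 0, p \isn't a GRing.unit
    & forall a b, divides p (a * b) -> divides p a \/ divides p b].

Inductive prime_product : nat -> A -> Prop :=
| prime_product_unit u : u \is a GRing.unit -> prime_product 0 u
| prime_product_cons n p a :
    prime_elem p -> prime_product n a -> prime_product n.+1 (p * a).

Lemma prime_product_neq0 n a : prime_product n a -> a != 0.
Proof.
elim=> [u uu|m p b [p0 _ _] _ b0]; last exact: mulf_neq0.
by apply: contraTneq uu => ->; rewrite unitr0.
Qed.

Lemma prime_product_unitM n u a :
  u \is a GRing.unit -> prime_product n a -> prime_product n (u * a).
Proof.
move=> uu; elim=> [v uv|m p b pr_p _ IHb].
  by apply: prime_product_unit; rewrite unitrM uu.
by rewrite mulrCA; apply: prime_product_cons.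
Qed.

Lemma prime_productM m n a b :
  prime_product m a -> prime_product n b -> prime_product (m + n) (a * b).
Proof.
move=> pa pb; elim: pa => [u uu|k p c pr_p _ IHc]; first exact: prime_product_unitM.
by rewrite -mulrA addSn; apply: prime_product_cons.
Qed.

Lemma prime_divides_prime p q :
  prime_elem p -> prime_elem q -> divides p q -> exists2 u, u \is a GRing.unit & q = p * u.
Proof.
move=> [_ nup _] [q0 _ pr_q] [u Dq]; exists u => //.
have [[v Dp]|[v Du]] : divides q p \/ divides q u.
- by apply: pr_q; exists 1; rewrite mulr1.
- apply/unitrPr; exists v; apply: (mulfI q0).
  by rewrite mulr1 [RHS]Dq Dp; ring.
case/negP: nup; apply/unitrPr; exists v; apply: (mulfI q0).
by rewrite mulr1 mulrCA -Du.
Qed.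

Lemma prime_product_cancel n p b :
  prime_elem p -> prime_product n (p * b) -> exists2 m, n = m.+1 & prime_product m b.
Proof.
move=> pr_p; move Da: (p * b) => a pa; elim: pa b Da => {n a} [u uu|n q a pr_q pa IHa] b Da.
  by case: pr_p => _ /negP[]; move: uu; rewrite -Da unitrM => /andP[].
have [p0 _ dvdM] := pr_p.
have [|p_q|[c Dc]] := dvdM q a; first by exists b.
  have [u uu Dq] := prime_divides_prime pr_p pr_q p_q.
  exists n => //; have -> : b = u * a by apply: (mulfI p0); rewrite Da Dq mulrA.
  exact: prime_product_unitM.
have [m -> pc] := IHa c (esym Dc); exists m.+1 => //.
have -> : b = q * c by apply: (mulfI p0); rewrite Da Dc mulrCA.
exact: prime_product_cons.
Qed.

End PrimeProducts.

Definition factorial_domain (A : idomainType) : Prop :=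
  forall a : A, a != 0 -> exists n, prime_product n a.

Section GaussLemma.
Variable A : idomainType.
Implicit Types (a b c p : A) (f g h u v : {poly A}).

Definition primitive_poly f : Prop := forall p, prime_elem p -> ~ divides p%:P f.

Lemma polyC_divides_mulX p f : divides p%:P (f * 'X) -> divides p%:P f.
Proof.
case=> h Efh; exists (drop_poly 1 h); apply/polyP=> i.
by rewrite coefCM coef_drop_poly addn1 -coefCM -Efh coefMX.
Qed.

Lemma prime_elem_polyC p : prime_elem p -> prime_elem p%:P.
Proof.
move=> [p0 nup pr_p]; split; rewrite ?polyC_eq0 //.
  by rewrite poly_unitE coefC negb_and nup orbT.
have dvd_cons f a : divides p a -> divides p%:P f -> divides p%:P (f * 'X + a%:P).
  move=> [b ->] [g ->]; exists (g * 'X + b%:P).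
  by rewrite polyCM mulrDr mulrA.
have dvd_tail f a g :
    divides p a -> divides p%:P ((f * 'X + a%:P) * g) -> divides p%:P (f * g).
  move=> [b ->] [h Eh]; apply: polyC_divides_mulX; exists (h - b%:P * g).
  by rewrite mulrBr -Eh polyCM; ring.
elim/poly_ind=> [|f a IHf] g; first by left; exists 0; rewrite mulr0.
elim/poly_ind: g => [|g b IHg]; first by right; exists 0; rewrite mulr0.
move=> dvd_fg; have [h /(congr1 (horner_eval 0))] := dvd_fg.
rewrite /horner_eval !hornerE /= => Eab.
have [|p_a|p_b] := pr_p a b; first by exists h.[0].
  by have [p_f|] := IHf _ (dvd_tail _ _ _ p_a dvd_fg); [left; apply: dvd_cons | right].
rewrite mulrC in dvd_fg.
have := dvd_tail _ _ _ p_b dvd_fg; rewrite mulrC => /IHg[|p_g]; [by left | right].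
exact: dvd_cons.
Qed.

Lemma prime_product_polyC n c : prime_product n c -> prime_product n c%:P.
Proof.
elim=> [u uu|m p a pr_p _ IHa]; first exact/prime_product_unit/rmorph_unit.
by rewrite polyCM; apply: prime_product_cons; first exact: prime_elem_polyC.
Qed.

Lemma polyC_mul_split n c h u v :
  prime_product n c -> c%:P * h = u * v ->
  exists c1 c2 u' v', [/\ c = c1 * c2, u = c1%:P * u', v = c2%:P * v' & h = u' * v'].
Proof.
move=> pc; elim: pc u v => {n c} [c uc|n p c pr_p _ IHc] u v Euv.
  exists c, 1, (c^-1%:P * u), v; split; rewrite ?mulr1 ?mul1r //.
    by rewrite mulrA -polyCM mulrV // mul1r.
  by rewrite -mulrA -Euv mulrA -polyCM mulVr ?mul1r.
have [p0 _ pr_pC] := prime_elem_polyC pr_p.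
have [|[u1 Du]|[v1 Dv]] := pr_pC u v; first by exists (c%:P * h); rewrite -Euv polyCM mulrA.
  have [|c1 [c2 [u' [v' [-> Du1 -> ->]]]]] := IHc u1 v.
    by apply: (mulfI p0); rewrite mulrA -polyCM Euv Du mulrA.
  by exists (p * c1), c2, u', v'; rewrite Du Du1 polyCM !mulrA.
have [|c1 [c2 [u' [v' [-> -> Dv1 ->]]]]] := IHc u v1.
  by apply: (mulfI p0); rewrite mulrA -polyCM Euv Dv mulrCA.
by exists c1, (p * c2), u', v'; rewrite mulrCA; split; rewrite // Dv Dv1 polyCM mulrA.
Qed.

Lemma coprimep_bezoutC f g :
  coprimep f g -> exists c u v, c != 0 /\ c%:P = u * f + v * g.
Proof.
move=> cop; have [[u v] /= /Pdiv.Idomain.eqpP[[c d] /= /andP[_ d0] Euv]] :=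
  Pdiv.Idomain.Bezout_coprimepP _ _ cop.
exists d, (c%:P * u), (c%:P * v); split=> //.
by rewrite -!mulrA -mulrDr mul_polyC Euv -mul_polyC mulr1.
Qed.

Hypothesis factA : factorial_domain A.

Lemma primitive_poly_unit f c g :
  f != 0 -> primitive_poly f -> f = c%:P * g -> c \is a GRing.unit.
Proof.
move=> f0 primf Df; have c0 : c != 0 by apply: contraNneq f0 => c0; rewrite Df c0 mul0r.
have [n pc] := factA c0; case: pc Df => // m p a pr_p _ Df.
by case: (primf p pr_p); exists (a%:P * g); rewrite Df polyCM mulrA.
Qed.

Lemma primitive_part f :
  f != 0 -> exists c g, [/\ c != 0, f = c%:P * g & primitive_poly g].
Proof.
move=> f0; have lf0 : lead_coef f != 0 by rewrite lead_coef_eq0.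
have [n] := factA lf0; elim/ltn_ind: n f f0 {lf0} => n IHn f f0 pf.
have [primf|/existsNP[p /not_implyP[pr_p /contrapT[g Dg]]]] := EM (primitive_poly f).
  by exists 1, f; rewrite mul1r oner_neq0.
move: pf; rewrite Dg lead_coefM lead_coefC => /(prime_product_cancel pr_p)[m Dn pg].
have g0 : g != 0 by apply: contraNneq f0 => g0; rewrite Dg g0 mulr0.
have [|c [h [c0 -> primh]]] := IHn m _ g g0 pg; first by rewrite Dn.
exists (p * c), h; rewrite polyCM mulrA; split=> //.
by rewrite mulf_neq0 //; case: pr_p.
Qed.

Lemma primitive_divides_polyCM f c g :
  f != 0 -> primitive_poly f -> c != 0 -> divides f (c%:P * g) -> divides f g.
Proof.
move=> f0 primf c0 [w Ew]; have [n pc] := factA c0.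
have [c1 [c2 [f' [w' [_ Df _ ->]]]]] := polyC_mul_split pc Ew.
have uc1 := primitive_poly_unit f0 primf Df.
exists (c1^-1%:P * w'); rewrite {1}Df.
by rewrite mulrACA -polyCM mulrV // mul1r.
Qed.

(* Euclid's lemma over the fraction field of [A]; Gauss's lemma clears the denominators. *)
Lemma primitive_irreducible_prime f :
  primitive_poly f -> (1 < size f)%N ->
  (forall u v, f = u * v -> (size u <= 1)%N \/ (size v <= 1)%N) -> prime_elem f.
Proof.
move=> primf szf irrf; have f0 : f != 0 by rewrite -size_poly_gt0 ltnW.
split=> // [|g v [u Egv]]; first by rewrite poly_unitE negb_and neq_ltn szf orbT.
have [szh|szh] := leqP (size (gcdp f g)) 1.
  right; have cop : coprimep f g.
    by rewrite coprimep_def eqn_leq szh size_poly_gt0 gcdp_eq0 negb_and f0.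
  have [c [a [b [c0 Dc]]]] := coprimep_bezoutC cop.
  apply: (primitive_divides_polyCM f0 primf c0); exists (a * v + b * u).
  by rewrite Dc mulrDl -!mulrA Egv; ring.
left; set h := gcdp f g in szh.
have [[c q] /= c0] := Pdiv.Idomain.dvdpP _ _ (Pdiv.Idomain.dvdp_gcdl f g).
have [[d r] /= d0] := Pdiv.Idomain.dvdpP _ _ (Pdiv.Idomain.dvdp_gcdr f g).
rewrite -!mul_polyC -/h => Eg Ef; have [n pc] := factA c0.
have [c1 [c2 [q' [h' [Dc _ Dh Df]]]]] := polyC_mul_split pc Ef.
have szh' : (1 < size h')%N.
  apply: leq_trans szh _; rewrite Dh; case: (eqVneq c2 0) => [->|c20].
    by rewrite mul0r size_poly0.
  by rewrite mul_polyC size_scale.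
have [/size1_polyC Dq'|] := irrf _ _ Df; last by rewrite leqNgt szh'.
have uq' : q'`_0 \is a GRing.unit.
  by apply: (primitive_poly_unit f0 primf (g := h')); rewrite -Dq'.
have Dh' : h' = (q'`_0)^-1%:P * f.
  by rewrite Df {2}Dq' mulrA -polyCM mulVr ?mul1r.
apply: (primitive_divides_polyCM f0 primf d0).
by exists (r * c2%:P * (q'`_0)^-1%:P); rewrite Eg Dh Dh'; ring.
Qed.

Theorem poly_factorial : factorial_domain {poly A}.
Proof.
move=> f; have [n] := ubnP (size f); elim: n f => // n IHn f lt_fn f0.
have [/size1_polyC Df|szf] := leqP (size f) 1.
  rewrite Df polyC_eq0 in f0; have [m pm] := factA f0.
  by exists m; rewrite Df; apply: prime_product_polyC.
have [[u [v [Df szu szv]]]|irrf] :=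
  EM (exists u v, [/\ f = u * v, (1 < size u)%N & (1 < size v)%N]).
  have u0 : u != 0 by rewrite -size_poly_gt0 ltnW.
  have v0 : v != 0 by rewrite -size_poly_gt0 ltnW.
  have szuv : size f = (size u + size v).-1 by rewrite Df size_mul.
  have [|k pu] := IHn u _ u0; first lia.
  have [|l pv] := IHn v _ v0; first lia.
  by exists (k + l)%N; rewrite Df; apply: prime_productM.
have [c [g [c0 Df primg]]] := primitive_part f0; have [m pm] := factA c0.
have pr_g : prime_elem g.
  apply: primitive_irreducible_prime => // [|u v Dg].
    by rewrite Df mul_polyC size_scale in szf.
  have [|szu] := leqP (size u) 1; [by left | right].
  rewrite leqNgt; apply/negP=> szv; apply: irrf; exists (c%:P * u), v.
  by rewrite Df Dg mulrA mul_polyC size_scale.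
exists m.+1; rewrite Df mulrC; apply: prime_product_cons => //.
exact: prime_product_polyC.
Qed.

End GaussLemma.

Lemma factorial_domain_bij (A B : idomainType) (f : {rmorphism A -> B}) :
  bijective f -> factorial_domain B -> factorial_domain A.
Proof.
case=> g fK gK factB; have f_inj := can_inj fK.
have dvdf a b : divides (f a) (f b) <-> divides a b.
  split=> [[c Eb]|]; last exact: divides_rmorph.
  by exists (g c); apply: f_inj; rewrite rmorphM /= gK.
have unitf a : f a \is a GRing.unit -> a \is a GRing.unit.
  case/unitrPr=> c Ec; apply/unitrPr; exists (g c).
  by apply: f_inj; rewrite rmorphM rmorph1 /= gK.
have primef p : prime_elem (f p) -> prime_elem p.
  case=> fp0 nufp pr_fp; split=> [||a b].
  - by apply: contraNneq fp0 => ->; rewrite rmorph0.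
  - by apply: contraNN nufp => /(rmorph_unit f).
  by move/dvdf; rewrite rmorphM => /pr_fp[/dvdf|/dvdf]; [left | right].
suff prodf n b : prime_product n b -> prime_product n (g b).
  move=> a a0; have [|n pa] := factB (f a); first by rewrite -(rmorph0 f) inj_eq.
  by exists n; rewrite -(fK a); apply: prodf.
elim=> {n b} [u uu|n p b pr_p _ IHb]; first by apply/prime_product_unit/unitf; rewrite gK.
have -> : g (p * b) = g p * g b by apply: f_inj; rewrite rmorphM /= !gK.
by apply: prime_product_cons => //; apply: primef; rewrite gK.
Qed.

Lemma eq_rmorph_mpoly (K S : comNzRingType) n (f g : {rmorphism {mpoly K[n]} -> S}) :
  (forall c, f c%:MP = g c%:MP) -> (forall i, f 'X_i = g 'X_i) -> f =1 g.
Proof.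
move=> fgC fgX p; rewrite [p]mpolyE !rmorph_sum; apply: eq_bigr => m _.
rewrite -mul_mpolyC !rmorphM fgC mpolyXE_id !rmorph_prod; congr (_ * _).
by apply: eq_bigr => i _; rewrite !rmorphXn fgX.
Qed.

Section LastVariable.
Variables (K : comNzRingType) (n : nat).
Local Notation widen := (widen_ord (leqnSn n)).

Lemma lift_ord_max i : lift ord_max i = widen i.
Proof. by apply: ord_inj; rewrite lift_max. Qed.

Lemma widen_ord_max_ind (P : 'I_n.+1 -> Prop) :
  (forall i, P (widen i)) -> P ord_max -> forall i, P i.
Proof.
by move=> Pw Pm i; case: (unliftP ord_max i) => [j|] ->; rewrite ?lift_ord_max.
Qed.

Lemma muniX_widen i : muni ('X_(widen i) : {mpoly K[n.+1]}) = ('X_i)%:P.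
Proof.
rewrite muniE msuppX big_seq1 mcoeffX eqxx scale1r mnm1E.
have -> : (widen i == ord_max) = false by rewrite -val_eqE /= ltn_eqF.
rewrite expr0 alg_polyC; congr ('X_[_])%:P; apply/mnmP=> j.
by rewrite mnmE !mnm1E -val_eqE.
Qed.

Lemma muniX_ord_max : muni ('X_ord_max : {mpoly K[n.+1]}) = 'X.
Proof.
rewrite muniE msuppX big_seq1 mcoeffX eqxx scale1r mnm1E eqxx expr1.
rewrite (_ : [multinom _ | _ < _] = 0%MM) ?mpolyX0 ?scale1r //.
by apply/mnmP=> j; rewrite mnmE mnm1E mnm0E -val_eqE /= gtn_eqF.
Qed.

Lemma mwidenXU i : mwiden ('X_i : {mpoly K[n]}) = 'X_(widen i).
Proof. by rewrite mwidenX mnmwiden1. Qed.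

Definition muni_inv : {poly {mpoly K[n]}} -> {mpoly K[n.+1]} :=
  horner_eval 'X_ord_max \o map_poly (@mwiden n K).

HB.instance Definition _ := GRing.RMorphism.copy muni_inv
  (horner_eval 'X_ord_max \o map_poly (@mwiden n K)).

Lemma muni_invC p : muni_inv p%:P = mwiden p.
Proof. by rewrite /muni_inv /= map_polyC /horner_eval hornerC. Qed.

Lemma muni_invX : muni_inv 'X = 'X_ord_max.
Proof. by rewrite /muni_inv /= map_polyX /horner_eval hornerX. Qed.

Lemma muni_mwiden (p : {mpoly K[n]}) : muni (mwiden p) = p%:P.
Proof.
apply: (eq_rmorph_mpoly (f := @muni n K \o @mwiden n K) (g := @polyC _)) => [c|i] /=.
  by rewrite mwidenC muniC.
by rewrite mwidenXU muniX_widen.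
Qed.

Lemma muniK : cancel (@muni n K) muni_inv.
Proof.
apply: (eq_rmorph_mpoly (f := muni_inv \o @muni n K) (g := idfun)) => [c|] /=.
  by rewrite muniC muni_invC mwidenC.
apply: widen_ord_max_ind => [i|]; last by rewrite muniX_ord_max muni_invX.
by rewrite muniX_widen muni_invC mwidenXU.
Qed.

Lemma muni_invK : cancel muni_inv (@muni n K).
Proof.
elim/poly_ind=> [|p c IHp]; first by rewrite !rmorph0.
by rewrite !rmorphD !rmorphM /= IHp muni_invX muni_invC muniX_ord_max muni_mwiden.
Qed.

Lemma bij_muni : bijective (@muni n K).
Proof. exact: Bijective muniK muni_invK. Qed.

Lemma meval_muni (v : 'I_n.+1 -> K) (p : {mpoly K[n.+1]}) :
  p.@[v] = (map_poly (meval (v \o widen)) (muni p)).[v ord_max].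
Proof.
apply: (eq_rmorph_mpoly (f := meval v)
  (g := horner_eval (v ord_max) \o map_poly (meval (v \o widen)) \o @muni n K)) => [c|] /=.
  by rewrite muniC map_polyC /horner_eval hornerC /= !mevalC.
rewrite /horner_eval; apply: widen_ord_max_ind => [i|].
  by rewrite muniX_widen map_polyC hornerC /= !mevalXU.
by rewrite muniX_ord_max map_polyX hornerX mevalXU.
Qed.

End LastVariable.

Lemma unit_mpolyC (K : fieldType) n (c : K) :
  c != 0 -> (c%:MP : {mpoly K[n]}) \is a GRing.unit.
Proof. by move=> c0; apply: (rmorph_unit (@mpolyC n K)); rewrite unitfE. Qed.

Theorem mpoly_factorial (K : fieldType) n : factorial_domain {mpoly K[n]}.
Proof.
elim: n => [|n IHn]; last exact: factorial_domain_bij (bij_muni K n) (poly_factorial IHn).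
move=> p p0; exists 0%N; apply: prime_product_unit.
by move: p0; rewrite [p]nvar0_mpolyC mpolyC_eq0; apply: unit_mpolyC.
Qed.

(** * Zeros of a nonconstant polynomial *)

Lemma exists_meval_neq0 (K : closedFieldType) n (p : {mpoly K[n]}) :
  p != 0 -> exists v : {ffun 'I_n -> K}, p.@[v] != 0.
Proof.
elim: n p => [|n IHn] p p0.
  exists [ffun=> 0]; move: p0; rewrite [p]nvar0_mpolyC mevalC.
  by apply: contraNneq => ->; rewrite mpolyC0.
have mp0 : muni p != 0 by apply: contraNneq p0 => mp0; rewrite -(muniK p) mp0 rmorph0.
have [|v lv] := IHn (lead_coef (muni p)); first by rewrite lead_coef_eq0.
have : map_poly (meval v) (muni p) != 0 by rewrite map_poly_eq0_id0.
case/closed_nonrootP=> a pa.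
exists [ffun i => if unlift ord_max i is Some j then v j else a].
rewrite meval_muni ffunE unlift_none; apply: contraNN pa; congr (_ == _).
congr _.[_]; apply: eq_map_poly => q; apply: meval_eq => i /=.
by rewrite -lift_ord_max ffunE liftK.
Qed.

Lemma ffun_neq_exists (I : finType) (T : eqType) (v w : {ffun I -> T}) :
  v != w -> exists i, v i != w i.
Proof.
move=> ne_vw; apply/existsP; apply: contraNT ne_vw; rewrite negb_exists.
by move/forallP=> eq_vw; apply/eqP/ffunP=> i; apply/eqP; rewrite -[_ == _]negbK.
Qed.

Definition mline (K : comNzRingType) n (v w : 'I_n -> K) : {mpoly K[n]} -> {poly K} :=
  mmap polyC (fun i => (v i)%:P + 'X * (w i)%:P).

Lemma horner_mline (K : comNzRingType) n (v w : 'I_n -> K) (p : {mpoly K[n]}) t :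
  (mline v w p).[t] = p.@[fun i => v i + t * w i].
Proof.
apply: (eq_rmorph_mpoly (g := meval _)
  (f := horner_eval t \o mmap polyC (fun i => (v i)%:P + 'X * (w i)%:P))) => [c|i] /=.
  by rewrite mmapC mevalC /horner_eval hornerC.
by rewrite mmapX mmap1U mevalXU /horner_eval !hornerE.
Qed.

Lemma nonconst_meval_neq (K : closedFieldType) n (G : {mpoly K[n]}) :
  nonconst G -> exists w : {ffun 'I_n -> K}, G.@[w] != G.@[fun=> 0].
Proof.
move=> ncG; have [|w] := @exists_meval_neq0 _ _ (G - (G.@[fun=> 0])%:MP).
  by rewrite subr_eq0; apply/eqP=> DG; apply: ncG; exists G.@[fun=> 0].
by rewrite mevalB mevalC subr_eq0; exists w.
Qed.

(* Let [G w != G 0], and let [e] be a basis vector that is not proportional to [w]. The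
   line through [c e] directed by [w] has both properties for all but finitely many [c]. *)
Lemma nonconst_generic_line (K : closedFieldType) n (G : {mpoly K[n.+2]})
    (s : seq {ffun 'I_n.+2 -> K}) :
  nonconst G -> exists v w : 'I_n.+2 -> K,
    size (mline v w G) != 1 /\ forall t, [ffun i => v i + t * w i] \notin s.
Proof.
case/nonconst_meval_neq=> w Gw.
have [|i] := @ffun_neq_exists _ _ w [ffun=> 0].
  by apply: contraNneq Gw => ->; apply/eqP/meval_eq => i; rewrite ffunE.
rewrite ffunE => wi.
have [j ne_ij] : exists j, i != j.
  by have [->|] := eqVneq i ord0; [exists ord_max | exists ord0].
pose e (l : 'I_n.+2) : K := (l == j)%:R.
pose h := mline w e G - mline (fun=> 0) e G.
have hE c : h.[c] = G.@[fun l => w l + c * e l] - G.@[fun l => 0 + c * e l].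
  by rewrite hornerD hornerN !horner_mline.
have h0 : h != 0.
  apply: contraNneq Gw => h0; rewrite -subr_eq0 -[X in _ == X](horner0 0) -h0 hE.
  by apply/eqP; congr (_ - _); apply: meval_eq => l; rewrite mul0r addr0.
pose bad := [seq v j - v i / w i * w j | v : {ffun 'I_n.+2 -> K} <- s].
have [c] : exists c, ~~ root (h * \prod_(b <- bad) ('X - b%:P)) c.
  apply: closed_nonrootP; rewrite mulf_neq0 // prodf_seq_neq0.
  by apply/allP=> b _ /=; rewrite polyXsubC_eq0.
rewrite rootM negb_or root_prod_XsubC => /andP[hc good_c].
exists (fun l => c * e l), w; split=> [|t].
  apply: contraNneq hc => /eqP/size_poly1P[k _ Dk].
  have Gk t : G.@[fun l => c * e l + t * w l] = k by rewrite -horner_mline Dk hornerC.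
  rewrite rootE hE subr_eq0; apply/eqP.
  by transitivity k; [rewrite -(Gk 1) | rewrite -(Gk 0)]; apply: meval_eq => l; ring.
apply: contraNN good_c => sv; apply/mapP.
exists [ffun l => c * e l + t * w l] => //.
by rewrite !ffunE /e eqxx (negPf ne_ij) mulr1 mulr0 add0r mulfK // addrK.
Qed.

Lemma nonconst_zero_notin (K : closedFieldType) n (G : {mpoly K[n.+2]})
    (s : seq {ffun 'I_n.+2 -> K}) :
  nonconst G -> exists2 v : {ffun 'I_n.+2 -> K}, v \notin s & G.@[v] = 0.
Proof.
move=> ncG; have [v [w [sz_line line_s]]] := nonconst_generic_line s ncG.
case/closed_rootP: sz_line => t; rewrite rootE horner_mline => /eqP Gt.
exists [ffun i => v i + t * w i]; first exact: line_s.
by rewrite -Gt; apply: meval_eq => i; rewrite ffunE.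
Qed.

Definition pt2 (K : Type) (p : K * K) : {ffun 'I_2 -> K} :=
  [ffun i : 'I_2 => if i == 0 then p.1 else p.2].

Definition pt2_inv (K : Type) (v : {ffun 'I_2 -> K}) : K * K := (v 0, v 1).

Lemma ord2P (i : 'I_2) : i = 0 \/ i = 1.
Proof. by case: i => [[|[|]]] // lt2; [left | right]; apply: val_inj. Qed.

Lemma pt2K (K : Type) : cancel (@pt2 K) (@pt2_inv K).
Proof. by case=> x y; rewrite /pt2_inv !ffunE. Qed.

Lemma pt2_invK (K : Type) : cancel (@pt2_inv K) (@pt2 K).
Proof. by move=> v; apply/ffunP=> i; rewrite ffunE; case: (ord2P i) => ->. Qed.

Lemma nonconst_card_zeros (K : closedFieldType) (G : {mpoly K[2]}) n :
  nonconst G -> card_gt (fun p => G.@[pt2 p] = 0) n.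
Proof.
move=> ncG; suff [s us [Gs szs]] : exists2 s : seq {ffun 'I_2 -> K},
    uniq s & (forall v, v \in s -> G.@[v] = 0) /\ size s = n.+1.
  exists (map (@pt2_inv K) s).
  rewrite (map_inj_uniq (can_inj (@pt2_invK K))) size_map szs.
  by do 2!split=> //; move=> _ /mapP[v sv ->]; rewrite pt2_invK; apply: Gs.
elim: n.+1 => [|m [s us [Gs szs]]]; first by exists [::].
have [v sv Gv] := nonconst_zero_notin s ncG.
exists (v :: s); first by rewrite /= sv.
by rewrite /= szs; split=> // w; rewrite inE => /predU1P[->|/Gs].
Qed.

(** * Bezout's inequality *)

Lemma card_bmultinom_mdeg n k d :
  (d < k)%N -> #|[pred m : 'X_{1..n.+1 < k} | mdeg m == d]| = 'C(d + n, d).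
Proof.
move=> lt_dk; rewrite -size_basis cardE -(size_map val); apply/perm_size/uniq_perm.
- by rewrite map_inj_uniq ?enum_uniq //; apply: val_inj.
- exact: uniq_basis.
move=> m; rewrite -basis_cover; apply/mapP/idP=> [[b]|dm].
  by rewrite mem_enum => Db ->.
have lt_m : (mdeg m < k)%N by rewrite (eqP dm).
by exists (BMultinom lt_m); rewrite // mem_enum.
Qed.

Lemma card_bmultinom n k : #|{: 'X_{1..n.+1 < k}}| = 'C(k + n, n.+1).
Proof.
transitivity (\sum_(d < k) 'C(d + n, d))%N.
  rewrite -sum1_card (partition_big (fun m => Ordinal (bmdeg m)) xpredT) //=.
  apply: eq_bigr => d _; rewrite -(card_bmultinom_mdeg _ (ltn_ord d)) -sum1_card.
  by apply: eq_bigl => m; rewrite !inE -val_eqE.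
elim: k => [|k IHk]; first by rewrite big_ord0 add0n bin_small.
by rewrite big_ord_recr IHk /= addSn binS -(bin_sub (leq_addl k n)) addnK.
Qed.

Lemma card_bmultinom2_second_diff m n r :
  (#|{: 'X_{1..2 < m + n + r}}| + #|{: 'X_{1..2 < r}}| =
   #|{: 'X_{1..2 < n + r}}| + #|{: 'X_{1..2 < m + r}}| + m * n)%N.
Proof.
rewrite !card_bmultinom !addn1; elim: m => [|m IHm]; first by rewrite !add0n mul0n addn0.
by rewrite !addSn ['C((m + n + r).+2, 2)]binS ['C((m + r).+2, 2)]binS !bin1; lia.
Qed.

Lemma leq_msizeM (A : idomainType) n (p q : {mpoly A[n]}) :
  (msize (p * q) <= (msize p + msize q).-1)%N.
Proof.
have [->|p0] := eqVneq p 0; first by rewrite mul0r msize0.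
have [->|q0] := eqVneq q 0; first by rewrite mulr0 msize0.
by rewrite msizeM.
Qed.

Section BoundedDegree.
Variables (K : fieldType) (n : nat).
Local Notation monos k := #|{: 'X_{1..n < k}}|.

Definition rVmpoly k (v : 'rV[K]_(monos k)) : {mpoly K[n]} :=
  \sum_(m : 'X_{1..n < k}) v 0 (enum_rank m) *: 'X_[m].

Definition mpoly_rV k (p : {mpoly K[n]}) : 'rV[K]_(monos k) :=
  \row_i p@_(bmnm (enum_val i)).

Fact rVmpoly_is_linear k : linear (@rVmpoly k).
Proof.
move=> a u v; rewrite /rVmpoly scaler_sumr -big_split; apply: eq_bigr => m _ /=.
by rewrite !mxE scalerA -scalerDl.
Qed.

HB.instance Definition _ k :=
  GRing.isLinear.Build K _ _ _ (@rVmpoly k) (@rVmpoly_is_linear k).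

Fact mpoly_rV_is_linear k : linear (mpoly_rV k).
Proof. by move=> a p q; apply/rowP=> i; rewrite !mxE linearP. Qed.

HB.instance Definition _ k :=
  GRing.isLinear.Build K _ _ _ (mpoly_rV k) (mpoly_rV_is_linear k).

Lemma rVmpolyK k : cancel (@rVmpoly k) (mpoly_rV k).
Proof.
move=> v; apply/rowP=> i; rewrite mxE raddf_sum (bigD1 (enum_val i)) //=.
rewrite mcoeffZ mcoeffX eqxx mulr1 enum_valK big1 ?addr0 // => m ne_mi.
by rewrite mcoeffZ mcoeffX -bmeqP (negPf ne_mi) mulr0.
Qed.

Lemma mpoly_rVK k p : (msize p <= k)%N -> rVmpoly (mpoly_rV k p) = p.
Proof.
by move=> szp; rewrite [RHS](mpolywE szp); apply: eq_bigr => m _; rewrite mxE enum_rankK.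
Qed.

Lemma msize_rVmpoly k (v : 'rV_(monos k)) : (msize (rVmpoly v) <= k)%N.
Proof.
apply: leq_trans (msize_sum _ _ _) _; apply/bigmax_leqP => m _.
by apply: leq_trans (msizeZ_le _ _) _; rewrite msizeX bmdeg.
Qed.

Definition mul_mpoly_mx k k' (f : {mpoly K[n]}) : 'M_(monos k, monos k') :=
  lin1_mx (mpoly_rV k' \o (f \*o @rVmpoly k)).

Lemma rVmpoly_mul_mpoly_mx k k' f (v : 'rV_(monos k)) :
  (msize f + k <= k'.+1)%N -> rVmpoly (v *m mul_mpoly_mx k k' f) = f * rVmpoly v.
Proof.
move=> le_k; rewrite mul_rV_lin1 /= mpoly_rVK //.
apply: leq_trans (leq_msizeM _ _) _; rewrite -subn1 leq_subLR.
by apply: leq_trans le_k; rewrite leq_add2l msize_rVmpoly.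
Qed.

Lemma mxrank_mul_mpoly_mx k k' f :
  f != 0 -> (msize f + k <= k'.+1)%N -> \rank (mul_mpoly_mx k k' f) = monos k.
Proof.
move=> f0 le_k; apply/eqP/inj_row_free => v v0.
apply: (can_inj (@rVmpolyK k)); apply/eqP; rewrite linear0.
have := rVmpoly_mul_mpoly_mx v le_k; rewrite v0 linear0 => /esym/eqP.
by rewrite mulf_eq0 (negPf f0).
Qed.

Definition eval_rV r (s : r.-tuple {ffun 'I_n -> K}) (p : {mpoly K[n]}) : 'rV_r :=
  \row_j p.@[tnth s j].

Fact eval_rV_is_linear r (s : r.-tuple {ffun 'I_n -> K}) : linear (eval_rV s).
Proof. by move=> a p q; apply/rowP=> j; rewrite !mxE mevalD mevalZ. Qed.

HB.instance Definition _ r (s : r.-tuple {ffun 'I_n -> K}) :=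
  GRing.isLinear.Build K _ _ _ (eval_rV s) (eval_rV_is_linear s).

Definition eval_mx k r (s : r.-tuple {ffun 'I_n -> K}) : 'M_(monos k, r) :=
  lin1_mx (eval_rV s \o @rVmpoly k).

Lemma lagrange_mpoly (s : seq {ffun 'I_n -> K}) (v : {ffun 'I_n -> K}) :
  v \notin s -> exists p : {mpoly K[n]},
    [/\ (msize p <= (size s).+1)%N, p.@[v] = 1 & forall w, w \in s -> p.@[w] = 0].
Proof.
elim: s => [|w s IHs]; first by exists 1; rewrite msize1 meval1.
rewrite inE negb_or => /andP[ne_vw /IHs[p [szp pv ps]]].
have [i ne_i] := ffun_neq_exists ne_vw.
exists ((v i - w i)^-1 *: ('X_i - (w i)%:MP) * p); split.
- apply: leq_trans (leq_msizeM _ _) _.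
  have szL : (msize ((v i - w i)^-1 *: ('X_i - (w i)%:MP) : {mpoly K[n]}) <= 2)%N.
    apply: leq_trans (msizeZ_le _ _) (leq_trans (msizeD_le _ _) _).
    by rewrite msizeN msizeX mdeg1 geq_max /= msizeC; case: (_ != 0).
  by have := leq_add szL szp; case: (_ + _)%N.
- by rewrite mevalM pv mevalZ mevalB mevalXU mevalC mulr1 mulVf // subr_eq0.
move=> u; rewrite inE mevalM mevalZ mevalB mevalXU mevalC => /predU1P[->|/ps->].
  by rewrite subrr mulr0 mul0r.
by rewrite mulr0.
Qed.

Lemma mxrank_eval_mx k r (s : r.-tuple {ffun 'I_n -> K}) :
  uniq s -> (r <= k)%N -> \rank (eval_mx k s) = r.
Proof.
move=> us le_rk; apply/eqP; rewrite -[_ == _]/(row_full _) -sub1mx.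
apply/row_subP=> j; rewrite row1; set v := tnth s j.
have [|p [szp pv ps]] := @lagrange_mpoly (rem v s) v.
  by rewrite mem_rem_uniq // inE eqxx.
have szpk : (msize p <= k)%N.
  apply: leq_trans szp _; rewrite size_rem ?mem_tnth // size_tuple.
  by rewrite prednK ?(leq_ltn_trans _ (ltn_ord j)).
apply/submxP; exists (mpoly_rV k p); rewrite mul_rV_lin1 /= mpoly_rVK //.
apply/rowP=> i; rewrite !mxE eqxx; have [->|ne_ij] := eqVneq i j; first by rewrite pv.
by rewrite andbF ps // mem_rem_uniq // inE mem_tnth (inj_eq (tuple_uniqP _ us)) ne_ij.
Qed.

End BoundedDegree.

Section BezoutPrime.
Variable K : fieldType.

Lemma mul_mpoly_eval_mx_eq0 n r (s : r.-tuple {ffun 'I_n -> K}) (f : {mpoly K[n]}) a k :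
  (msize f + a <= k.+1)%N -> (forall v, v \in s -> f.@[v] = 0) ->
  mul_mpoly_mx a k f *m eval_mx k s = 0.
Proof.
move=> le_k fs; apply/row_matrixP=> i; rewrite row_mul rowE row0.
rewrite mul_rV_lin1 /= rVmpoly_mul_mpoly_mx //; apply/rowP=> j.
by rewrite !mxE mevalM fs ?mul0r ?mem_tnth.
Qed.

Lemma capmx_mul_mpoly_mx n (f g : {mpoly K[n]}) a b c k :
  prime_elem f -> ~ divides f g ->
  (msize f + a <= k.+1)%N -> (msize g + b <= k.+1)%N -> (msize f + c = b.+1)%N ->
  (mul_mpoly_mx a k f :&: mul_mpoly_mx b k g <= mul_mpoly_mx c k (f * g))%MS.
Proof.
move=> [f0 _ pr_f] ndvd leA leB Eb; apply/rV_subP=> u.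
rewrite sub_capmx => /andP[/submxP[x Dx] /submxP[y Dy]].
have Efg : f * rVmpoly x = g * rVmpoly y.
  by rewrite -!(rVmpoly_mul_mpoly_mx (k' := k)) // -Dx -Dy.
have g0 : g != 0 by apply/eqP=> g0; apply: ndvd; exists 0; rewrite mulr0.
have [|//|[w Dw]] := pr_f g (rVmpoly y); first by exists (rVmpoly x).
have szw : (msize w <= c)%N.
  have [->|w0] := eqVneq w 0; first by rewrite msize0.
  rewrite -(leq_add2l (msize f)) Eb -add1n -leq_subLR subn1 -msizeM // -Dw.
  exact: msize_rVmpoly.
apply/submxP; exists (mpoly_rV c w); apply: (can_inj (@rVmpolyK K n k)).
rewrite rVmpoly_mul_mpoly_mx ?mpoly_rVK // ?Dy ?rVmpoly_mul_mpoly_mx //.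
  by rewrite Dw; ring.
apply: leq_trans leB; rewrite msizeM // (mpolySpred mdeg f0) addSn /= addnAC addnC.
by rewrite leq_add2l -ltnS -addSn -(mpolySpred mdeg f0) Eb.
Qed.

(* The polynomials of degree [< k] vanishing on [s] have codimension [size s] for large
   [k], and they contain [f V + g W] for suitable [V] and [W]; the dimension of this sum
   is known because [f V] and [g W] meet in multiples of [f g]. *)
Lemma bezout_prime (f g : {mpoly K[2]}) (s : seq {ffun 'I_2 -> K}) :
  prime_elem f -> ~ divides f g -> uniq s ->
  (forall v, v \in s -> f.@[v] = 0 /\ g.@[v] = 0) ->
  (size s <= (msize f).-1 * (msize g).-1)%N.
Proof.
move=> pr_f ndvd us fgs; have [f0 _ _] := pr_f.
have g0 : g != 0 by apply/eqP=> g0; apply: ndvd; exists 0; rewrite mulr0.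
have Df := mpolySpred mdeg f0; have Dg := mpolySpred mdeg g0.
set m := (msize f).-1 in Df *; set n := (msize g).-1 in Dg *; set r := size s.
pose k := (m + n + r)%N; pose E := eval_mx k (in_tuple s).
have leA : (msize f + (n + r) <= k.+1)%N by rewrite Df /k; lia.
have leB : (msize g + (m + r) <= k.+1)%N by rewrite Dg /k; lia.
pose A := mul_mpoly_mx (n + r) k f; pose B := mul_mpoly_mx (m + r) k g.
have rE : \rank E = r by apply: mxrank_eval_mx; rewrite // leq_addl.
have rAB : (\rank (A + B)%MS + r <= #|{: 'X_{1..2 < k}}|)%N.
  have : (\rank (A + B)%MS <= \rank (kermx E))%N.
    by rewrite mxrankS // addsmx_sub !sub_kermx !mul_mpoly_eval_mx_eq0 ?eqxx // => v /fgs[].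
  by have := rank_leq_row E; rewrite mxrank_ker rE; lia.
have rcap : (\rank (A :&: B)%MS <= #|{: 'X_{1..2 < r}}|)%N.
  apply: leq_trans (rank_leq_row (mul_mpoly_mx r k (f * g))).
  by apply/mxrankS/capmx_mul_mpoly_mx; rewrite // Df.
have := mxrank_sum_cap A B; rewrite !mxrank_mul_mpoly_mx // => rsum.
have := card_bmultinom2_second_diff m n r; rewrite -/k; lia.
Qed.

End BezoutPrime.

Lemma nonconst_mpolyX (R : nzRingType) n (i : 'I_n) : nonconst ('X_i : {mpoly R[n]}).
Proof.
by case=> c /(congr1 (fun p => msize p)); rewrite msizeX mdeg1 msizeC; case: (c == 0).
Qed.

Lemma prime_mpoly_nonconst (K : fieldType) n (f : {mpoly K[n]}) :
  prime_elem f -> nonconst f.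
Proof.
move=> [f0 /negP nuf _] [c Df]; apply: nuf.
by rewrite Df unit_mpolyC // -(mpolyC_eq0 n) -Df.
Qed.

Section CommonZeros.
Variables (K : fieldType) (d : nat) (I : Type) (u : I -> {mpoly K[2]}).
Hypothesis msize_u : forall i, (msize (u i) <= d.+1)%N.

Lemma size_common_zeros_le n f (s : seq {ffun 'I_2 -> K}) :
  prime_product n f ->
  (forall p, prime_elem p -> divides p f -> exists i, ~ divides p (u i)) ->
  uniq s -> (forall v, v \in s -> f.@[v] = 0 /\ forall i, (u i).@[v] = 0) ->
  (size s <= (msize f).-1 * d)%N.
Proof.
move=> pf; elim: pf s => {n f} [c uc|n p a pr_p pa IHa] s ndvd us sP.
  case: s {us} sP => // v s /(_ v (mem_head _ _))[c0 _].
  by have := rmorph_unit (meval v) uc; rewrite /= c0 unitr0.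
have [i ndvd_i] : exists i, ~ divides p (u i) by apply: ndvd => //; exists a.
pose zp := [pred v : {ffun 'I_2 -> K} | p.@[v] == 0].
have le_p : (size (filter zp s) <= (msize p).-1 * d)%N.
  apply: leq_trans (bezout_prime pr_p ndvd_i _ _) _; first exact: filter_uniq.
    by move=> v; rewrite mem_filter => /andP[/eqP pv /sP[_ /(_ i)]].
  by rewrite leq_mul2l -[(msize (u i)).-1]subn1 leq_subLR msize_u ?orbT.
have le_a : (size (filter (predC zp) s) <= (msize a).-1 * d)%N.
  apply: IHa => [q pr_q q_a||v]; [|exact: filter_uniq|].
    by apply: ndvd => //; apply: divides_mull.
  rewrite mem_filter => /andP[/= npv /sP[/eqP pav uv]]; split=> //; apply/eqP.
  by move: pav; rewrite mevalM mulf_eq0 (negPf npv).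
rewrite -(count_predC zp) -!size_filter; apply: leq_trans (leq_add le_p le_a) _.
have [p0 _ _] := pr_p; have a0 := prime_product_neq0 pa.
by rewrite -mulnDl msizeM // (mpolySpred mdeg p0) (mpolySpred mdeg a0) addnS.
Qed.

Theorem common_factor (s : seq (K * K)) :
  uniq s -> (d ^ 2 < size s)%N -> (forall p i, p \in s -> (u i).@[pt2 p] = 0) ->
  exists2 G, nonconst G & forall i, divides G (u i).
Proof.
move=> us lt_ds sP; have [[i ui0]|u0] := EM (exists i, u i != 0); last first.
  exists 'X_0 => [|i]; first exact: nonconst_mpolyX.
  by exists 0; rewrite mulr0; apply/eqP; apply: contra_notT u0 => ui0; exists i.
have [n pui] := mpoly_factorial ui0.
apply: contrapT => noG; move: lt_ds; rewrite ltnNge -(size_map (@pt2 K)) => /negP[].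
apply: leq_trans (size_common_zeros_le pui _ _ _) _ => [f pr_f _||v|].
- apply/existsNP => dvdu; apply: noG; exists f => //.
  exact: prime_mpoly_nonconst.
- by rewrite map_inj_uniq //; apply: can_inj (@pt2K K).
- by case/mapP=> p ps ->; split=> [|j]; apply: sP.
by rewrite -mulnn leq_mul2r -subn1 leq_subLR msize_u orbT.
Qed.

End CommonZeros.

(** * Cartesian polynomials *)

Section SeparatedVariables.
Variable K : comNzRingType.
Implicit Types (p q : K * K) (m : 'X_{1..4}) (G : {mpoly K[2]}) (F : {mpoly K[4]}).

HB.instance Definition _ :=
  GRing.LRMorphism.copy (@in_xy K) (comp_mpoly [tuple 'X_vx; 'X_vy]).

HB.instance Definition _ :=
  GRing.LRMorphism.copy (@in_st K) (comp_mpoly [tuple 'X_vs; 'X_vt]).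

Lemma meval_comp_mpoly2 n (v : 'I_n -> K) i j G :
  (G \mPo [tuple 'X_i; 'X_j]).@[v] = G.@[pt2 (v i, v j)].
Proof.
rewrite comp_mpoly_meval; apply: meval_eq => l; rewrite (tnth_nth 0) ffunE.
by case: (ord2P l) => ->; rewrite /= mevalXU.
Qed.

Lemma meval_in_xy p q G : (in_xy G).@[pt4 p q] = G.@[pt2 p].
Proof. by rewrite meval_comp_mpoly2 /pt4 /= !inordK //; case: p. Qed.

Lemma meval_in_st p q G : (in_st G).@[pt4 p q] = G.@[pt2 q].
Proof. by rewrite meval_comp_mpoly2 /pt4 /= !inordK //; case: q. Qed.

Definition xy_part m : 'X_{1..2} := [multinom m (tnth [tuple vx; vy] i) | i < 2].

Definition st_part m : 'X_{1..2} := [multinom m (tnth [tuple vs; vt] i) | i < 2].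

Lemma big_ord4 (T : Type) (idx : T) (op : Monoid.law idx) (f : 'I_4 -> T) :
  \big[op/idx]_i f i = op (op (f vx) (f vy)) (op (f vs) (f vt)).
Proof.
rewrite !big_ord_recl big_ord0 Monoid.mulm1 Monoid.mulmA.
by congr (op (op (f _) (f _)) (op (f _) (f _))); apply: val_inj; rewrite /= inordK.
Qed.

Lemma mdeg_xy_st m : mdeg m = (mdeg (xy_part m) + mdeg (st_part m))%N.
Proof. by rewrite !mdegE big_ord4 !big_ord_recl !big_ord0 !mnmE !addn0. Qed.

Lemma mpolyX_xy_st m :
  'X_[m] = in_xy 'X_[xy_part m] * in_st 'X_[st_part m] :> {mpoly K[4]}.
Proof.
rewrite /in_xy /in_st !comp_mpolyX mpolyXE_id big_ord4 !big_ord_recl !big_ord0 !mulr1.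
by rewrite !mnmE !(tnth_nth 0).
Qed.

Lemma mpoly_separated_sum F : exists r (a b : 'I_r -> {mpoly K[2]}),
  [/\ forall l, (msize (a l) <= msize F)%N, forall l, (msize (b l) <= msize F)%N
    & F = \sum_l in_xy (a l) * in_st (b l)].
Proof.
pose m := tnth (in_tuple (msupp F)).
have lt_m l : (mdeg (m l) < msize F)%N by apply/msize_mdeg_lt/mem_tnth.
exists (size (msupp F)), (fun l => F@_(m l) *: 'X_[xy_part (m l)]),
  (fun l => 'X_[st_part (m l)]).
split=> [l|l|].
- apply: leq_trans (msizeZ_le _ _) _; rewrite msizeX.
  by apply: leq_ltn_trans (lt_m l); rewrite mdeg_xy_st leq_addr.
- by rewrite msizeX; apply: leq_ltn_trans (lt_m l); rewrite mdeg_xy_st leq_addl.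
rewrite [LHS]mpolyE big_tnth; apply: eq_bigr => l _.
by rewrite -/m mpolyX_xy_st linearZ -scalerAl.
Qed.

Lemma cartesian_of_separated_sums r r' (u v : 'I_r -> {mpoly K[2]})
    (u' v' : 'I_r' -> {mpoly K[2]}) G H :
  nonconst G -> nonconst H -> (forall i, divides G (u i)) -> (forall l, divides H (v' l)) ->
  cartesian (\sum_i in_xy (u i) * in_st (v i) + \sum_l in_xy (u' l) * in_st (v' l)).
Proof.
move=> ncG ncH dvdG dvdH.
have [L ->] : divides (in_xy G) (\sum_i in_xy (u i) * in_st (v i)).
  by apply: divides_sum => i; apply/divides_mulr/(divides_rmorph (@in_xy K)).
have [M ->] : divides (in_st H) (\sum_l in_xy (u' l) * in_st (v' l)).
  by apply: divides_sum => l; apply/divides_mull/(divides_rmorph (@in_st K)).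
by exists G, H, L, M.
Qed.

End SeparatedVariables.

Lemma sum_mul_mx_split (K : pzRingType) (A : algType K) r (P : 'M[K]_r) (u v : 'I_r -> A) :
  \sum_l u l * v l =
    \sum_i (\sum_l P l i *: u l) * v i + \sum_l u l * (\sum_i (1%:M - P) l i *: v i).
Proof.
transitivity (\sum_l \sum_i (1%:M : 'M[K]_r) l i *: (u l * v i)).
  apply: eq_bigr => l _; rewrite (bigD1 l) //= mxE eqxx scale1r big1 ?addr0 // => i ne_il.
  by rewrite mxE eq_sym (negPf ne_il) scale0r.
under [X in _ = X + _]eq_bigr do rewrite mulr_suml.
rewrite [X in _ = X + _]exchange_big -big_split; apply: eq_bigr => l _ /=.
rewrite mulr_sumr -big_split; apply: eq_bigr => i _ /=.
rewrite -scalerAl -scalerAr -scalerDl; congr (_ *: _).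
by rewrite [(_ - P) l i]mxE [(- P) l i]mxE [RHS]addrC subrK.
Qed.

Lemma msize_lincomb_le (K : nzRingType) n r k (c : 'I_r -> K) (a : 'I_r -> {mpoly K[n]}) :
  (forall l, (msize (a l) <= k)%N) -> (msize (\sum_l c l *: a l) <= k)%N.
Proof.
move=> le_k; apply: leq_trans (msize_sum _ _ _) _; apply/bigmax_leqP => l _.
exact: leq_trans (msizeZ_le _ _) (le_k l).
Qed.

Lemma cartesian_of_grid (K : fieldType) (F : {mpoly K[4]}) (s t : seq (K * K)) :
  uniq s -> uniq t -> (mtdeg F ^ 2 < size s)%N -> (mtdeg F ^ 2 < size t)%N ->
  (forall p q, p \in s -> q \in t -> F.@[pt4 p q] = 0) -> cartesian F.
Proof.
move=> us ut lt_s lt_t F0.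
have [r [a [b [sz_a sz_b DF]]]] := mpoly_separated_sum F.
pose q := tnth (in_tuple t).
pose E := \matrix_(l < r, j < size t) (b l).@[pt2 (q j)].
pose P := E *m pinvmx E.
pose slice j := \sum_l E l j *: a l.
pose rest l := \sum_i (1%:M - P) l i *: b i.
have sz_slice j : (msize (slice j) <= (mtdeg F).+1)%N.
  by apply: msize_lincomb_le => l; apply: leq_trans (sz_a l) (leqSpred _).
have sz_rest l : (msize (rest l) <= (mtdeg F).+1)%N.
  by apply: msize_lincomb_le => i; apply: leq_trans (sz_b i) (leqSpred _).
have [p j ps|G ncG dvdG] := common_factor sz_slice us lt_s.
  rewrite -(F0 p (q j)) ?mem_tnth // [in RHS]DF !raddf_sum; apply: eq_bigr => l _.
  by rewrite /= mevalM meval_in_xy meval_in_st mevalZ mxE mulrC.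
have [_ l /seq_tnthP[j ->]|H ncH dvdH] := common_factor sz_rest ut lt_t.
  have : ((1%:M - P) *m E) l j = 0 by rewrite mulmxBl mul1mx mulmxKpV ?subrr ?mxE.
  rewrite mxE => <-; rewrite raddf_sum; apply: eq_bigr => i _.
  by rewrite /= mevalZ [E _ _]mxE.
have dvdPa i : divides G (\sum_l P l i *: a l).
  have -> : \sum_l P l i *: a l = \sum_j pinvmx E j i *: slice j.
    under [RHS]eq_bigr do rewrite scaler_sumr.
    rewrite exchange_big; apply: eq_bigr => l _ /=; rewrite mxE scaler_suml.
    by apply: eq_bigr => j _; rewrite scalerA mulrC.
  by apply: divides_sum => j; rewrite -mul_mpolyC; apply: divides_mull.
have -> : F = \sum_i in_xy (\sum_l P l i *: a l) * in_st (b i)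
            + \sum_l in_xy (a l) * in_st (rest l).
  rewrite DF (sum_mul_mx_split P).
  by congr (_ + _); apply: eq_bigr => i _; congr (_ * _);
    rewrite linear_sum; apply: eq_bigr => l _; rewrite linearZ.
exact: (cartesian_of_separated_sums _ _ ncG ncH dvdPa dvdH).
Qed.

Lemma grid_of_cartesian (K : closedFieldType) (F : {mpoly K[4]}) n :
  cartesian F ->
  exists I J : K * K -> Prop,
    card_gt I n /\ card_gt J n /\ forall p q, I p -> J q -> F.@[pt4 p q] = 0.
Proof.
case=> [G [H [L [M [ncG [ncH ->]]]]]].
exists (fun p => G.@[pt2 p] = 0), (fun q => H.@[pt2 q] = 0).
split; first exact: nonconst_card_zeros.
split; first exact: nonconst_card_zeros.
by move=> p q Gp Hq; rewrite mevalD !mevalM meval_in_xy meval_in_st Gp Hq !mul0r addr0.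
Qed.

Theorem theorem2p5 (R : realType) (F : {mpoly (CC R)[4]}) :
  cartesian F <->
  exists (I J : (CC R * CC R) -> Prop),
    card_gt I ((mtdeg F) ^ 2)%N /\ card_gt J ((mtdeg F) ^ 2)%N /\
    (forall p q, I p -> J q -> F.@[pt4 p q] = 0).
Proof.
split=> [cartF|[I [J [[s [us [sI lt_s]]] [[t [ut [tJ lt_t]]] F0]]]]].
  exact: (@grid_of_cartesian (complex R)).
apply: (@cartesian_of_grid (complex R) F s t us ut lt_s lt_t) => p q ps qt.
exact: F0 (sI p ps) (tJ q qt).
Qed.
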